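(* The geometries $\mathbb H^n_{\Lambda_\delta}=(\mathrm U(n,1;\Lambda_\delta),\mathrm{USt}(n,1;\Lambda_\delta))$, $\delta\in\mathbb R$, form a 1-parameter family of geometries: the pair $\mathbb H^n_{\Lambda_{\mathbb R}}=(\mathcal U(n,1;\Lambda_{\mathbb R}),\mathcal{USt}(n,1;\Lambda_{\mathbb R}))$, where $$\mathcal U(n,1;\Lambda_{\mathbb R})=\bigcup_{\delta\in\mathbb R}\mathrm U(n,1;\Lambda_\delta)\times\{\delta\},\qquad \mathcal{USt}(n,1;\Lambda_{\mathbb R})=\bigcup_{\delta\in\mathbb R}\mathrm{USt}(n,1;\Lambda_\delta)\times\{\delta\},$$ is a 1-parameter family of geometries.
   Context: For $\delta\in\mathbb R$, $\Lambda_\delta=\mathbb R[\lambda]/(\lambda^2=\delta)$ with conjugation $\overline{a+\lambda b}=a-\lambda b$; as a vector space $\Lambda_\delta=\mathbb R\oplus\lambda\mathbb R$ for all $\delta$. For matrices $A^\dagger=\overline A^{\,T}$. With $Q=\mathrm{diag}(I_n,-1)$: $\mathrm U(n,1;\Lambda_\delta)=\{A\in\mathrm M(n+1;\Lambda_\delta): A^\dagger QA=Q\}$; $\mathrm U(n;\Lambda_\delta)=\{A: A^\dagger A=I_n\}$; $\mathrm U(\Lambda_\delta)=\{u:u\overline u=1\}$; $\mathrm{USt}(n,1;\Lambda_\delta)=\left(\begin{smallmatrix}\mathrm U(n;\Lambda_\delta)&0\\0&\mathrm U(\Lambda_\delta)\end{smallmatrix}\right)$, which is the stabilizer of the class of $e_{n+1}$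 in $\mathbb H^n_{\Lambda_\delta}$. The total space $\mathrm M(n+1;\Lambda_{\mathbb R})=\bigcup_{\delta}\mathrm M(n+1;\Lambda_\delta)\times\{\delta\}$ is the smooth manifold $(\mathbb R\oplus\lambda\mathbb R)^{(n+1)^2}\times\mathbb R$ with projection to $\delta\in\mathbb R$, multiplication over $\delta$ being that of $\mathrm M(n+1;\Lambda_\delta)$. A 1-parameter family of Lie groups is a Lie groupoid with object manifold $\mathbb R$ and equal source and target maps: a smooth manifold $\mathcal G$ with a smooth submersion $\mathcal G\to\mathbb R$ and smooth fiberwise multiplication, inversion and identity section making every fiber a Lie group. A collection of subgroups $G_\delta<\mathrm{GL}(n+1;\Lambda_\delta)$ is a 1-parameter family if $\bigcup_\delta G_\delta\times\{\delta\}$, with the structure inherited from $\mathrm M(n+1;\Lambda_{\mathbb R})$, is one (a smooth submanifold on which the projection to $\mathbb R$ is a submersion). A 1-parameter family of geometries is a pair consisting of a 1-parameter family of automorphism groups together with a 1-parameter family of closed subgroups (point stabilizers) of these. *)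

(* Defs.v *)
From HB Require Import structures.
From mathcomp Require Import all_boot all_order all_algebra.
From mathcomp Require Import all_classical all_reals all_analysis.
From mathcomp Require Import ring.

Set Implicit Arguments.
Unset Strict Implicit.
Unset Printing Implicit Defensive.

Import Order.TTheory GRing.Theory Num.Theory.
Import numFieldNormedType.Exports.

Local Open Scope classical_set_scope.
Local Open Scope ring_scope.

(* [MkLam a b] is a + lambda b in R[lambda]/(lambda^2 = delta). *)
Record Lam (R : Type) (delta : R) : Type := MkLam { lre : R; llam : R }.
Arguments MkLam {R delta} _ _.

Section LamChoice.
Context (R : realType) (delta : R).

Definition prod_of_Lam (x : Lam delta) : R * R := (lre x, llam x).
Definition Lam_of_prod (x : R * R) : Lam delta := MkLam x.1 x.2.

Lemma prod_of_LamK : cancel prod_of_Lam Lam_of_prod.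
Proof. by case. Qed.

HB.instance Definition _ := Choice.copy (Lam delta) (can_type prod_of_LamK).

End LamChoice.

Section LamRing.
Context (R : realType) (delta : R).
Implicit Types x y z : Lam delta.

Definition Lam0 : Lam delta := MkLam 0 0.
Definition Lam1 : Lam delta := MkLam 1 0.
Definition Lam_add x y : Lam delta := MkLam (lre x + lre y) (llam x + llam y).
Definition Lam_opp x : Lam delta := MkLam (- lre x) (- llam x).
Definition Lam_mul x y : Lam delta :=
  MkLam (lre x * lre y + delta * (llam x * llam y))
        (lre x * llam y + llam x * lre y).

Lemma Lam_addA : associative Lam_add.
Proof. by move=> [? ?] [? ?] [? ?]; congr MkLam; rewrite /= addrA. Qed.
Lemma Lam_addC : commutative Lam_add.
Proof. by move=> [? ?] [? ?]; congr MkLam; rewrite /= addrC. Qed.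
Lemma Lam_add0 : left_id Lam0 Lam_add.
Proof. by move=> [? ?]; congr MkLam; rewrite /= add0r. Qed.
Lemma Lam_addN : left_inverse Lam0 Lam_opp Lam_add.
Proof. by move=> [? ?]; congr MkLam; rewrite /= addNr. Qed.

HB.instance Definition _ :=
  GRing.isZmodule.Build (Lam delta) Lam_addA Lam_addC Lam_add0 Lam_addN.

Lemma Lam_mulA : associative Lam_mul.
Proof. by move=> [? ?] [? ?] [? ?]; congr MkLam => /=; ring. Qed.
Lemma Lam_mulC : commutative Lam_mul.
Proof. by move=> [? ?] [? ?]; congr MkLam => /=; ring. Qed.
Lemma Lam_mul1 : left_id Lam1 Lam_mul.
Proof. by move=> [? ?]; congr MkLam => /=; ring. Qed.
Lemma Lam_mulDl : left_distributive Lam_mul +%R.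
Proof. by move=> [? ?] [? ?] [? ?]; congr MkLam => /=; ring. Qed.
Lemma Lam1_neq0 : Lam1 != 0.
Proof. by apply/eqP => -[] /eqP; rewrite oner_eq0. Qed.

HB.instance Definition _ := GRing.Zmodule_isComNzRing.Build (Lam delta)
  Lam_mulA Lam_mulC Lam_mul1 Lam_mulDl Lam1_neq0.

Definition lconj x : Lam delta := MkLam (lre x) (- llam x).

(* The norm x * conj x, which lies in R. *)
Definition lnorm x : R := lre x ^+ 2 - delta * llam x ^+ 2.

Lemma lnormM x y : lnorm (x * y) = lnorm x * lnorm y.
Proof. by case: x y => [? ?] [? ?]; rewrite /lnorm /=; ring. Qed.

Lemma mul_lconj x : x * lconj x = MkLam (lnorm x) 0.
Proof. by case: x => [? ?]; congr MkLam; rewrite /lnorm /=; ring. Qed.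

Definition Lam_unit : pred (Lam delta) := [pred x | lnorm x != 0].
Definition Lam_inv x : Lam delta :=
  if Lam_unit x then MkLam (lre x / lnorm x) (- llam x / lnorm x) else x.

Lemma Lam_mulVx : {in Lam_unit, left_inverse 1 Lam_inv *%R}.
Proof.
move=> x ux; rewrite /Lam_inv ifT //; move: ux; rewrite inE /=.
case: x => a b; rewrite /lnorm /= => ux.
by congr MkLam => /=; field.
Qed.

Lemma Lam_unitPl x y : y * x = 1 -> Lam_unit x.
Proof.
move=> yx1; have: lnorm (y * x) != 0.
  by rewrite yx1 /lnorm /= expr0n /= mulr0 subr0 expr1n oner_eq0.
by rewrite lnormM mulf_eq0 negb_or => /andP[].
Qed.

Lemma Lam_inv_out : {in [predC Lam_unit], Lam_inv =1 id}.
Proof. by move=> x ux; rewrite /Lam_inv ifN. Qed.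

HB.instance Definition _ := GRing.ComNzRing_hasMulInverse.Build (Lam delta)
  Lam_mulVx Lam_unitPl Lam_inv_out.

Lemma lambda_sq : (MkLam 0 1 : Lam delta) ^+ 2 = MkLam delta 0.
Proof. by rewrite expr2; congr MkLam => /=; ring. Qed.

Lemma Lam_decomp (a b : R) :
  MkLam a b = MkLam a 0 + MkLam 0 1 * MkLam b 0 :> Lam delta.
Proof. by congr MkLam => /=; ring. Qed.

End LamRing.

Section UnitaryGroups.
Context (R : realType) (delta : R).

Definition adjmx m (A : 'M[Lam delta]_m) : 'M[Lam delta]_m :=
  (map_mx (@lconj R delta) A)^T.

Definition Qmx n : 'M[Lam delta]_(n + 1) := block_mx 1%:M 0 0 (- 1%:M).

Definition U_indef n : set 'M[Lam delta]_(n + 1) :=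
  [set A | adjmx A *m Qmx n *m A = Qmx n].

Definition U_def n : set 'M[Lam delta]_n := [set A | adjmx A *m A = 1%:M].

Definition U_scalar : set (Lam delta) := [set u | u * lconj u = 1].

Definition USt n : set 'M[Lam delta]_(n + 1) :=
  [set A | exists B u, [/\ @U_def n B, U_scalar u &
                           A = block_mx B 0 0 (u%:M)]].

End UnitaryGroups.
Arguments U_indef {R} delta n.
Arguments USt {R} delta n.

(* Calculus.  The domains are meant to be finite-dimensional: continuity of
   each x |-> 'd f x v is then equivalent to continuity of x |-> 'd f x. *)
Section Smooth.
Context (R : realType).
Implicit Types V W : normedModType R.

Fixpoint Ck (k : nat) V W (U : set V) (f : V -> W) : Prop :=
  if k is k'.+1 then
    (forall x, U x -> differentiable f x) /\
    (forall v, Ck k' U (fun x => 'd f x v))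
  else forall x, U x -> {for x, continuous f}.

Definition smooth_in V W (U : set V) (f : V -> W) : Prop :=
  forall k, Ck k U f.

(* Smoothness on an arbitrary subset: local extendability to a smooth map on an
   open set; on a submanifold this is smoothness for the induced structure. *)
Definition smooth_on V W (S : set V) (f : V -> W) : Prop :=
  forall p, S p -> exists (U : set V) (g : V -> W),
    [/\ open U, U p, smooth_in U g & forall q, U q -> S q -> g q = f q].

(* Slice charts: Phi is a diffeomorphism U -> Y between open sets of V, and it
   straightens S to a k-dimensional linear subspace, given as the range of an
   injective linear map L.  A linear choice of coordinates on V turns this into
   the usual condition with R^k x 0. *)
Definition submanifold V (k : nat) (S : set V) : Prop :=
  forall p, S p ->
    exists (U Y : set V) (Phi Psi : V -> V) (L : {linear 'rV[R]_k -> V}),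
    [/\ [/\ open U, U p & open Y],
        smooth_in U Phi /\ smooth_in Y Psi,
        (forall x, U x -> Y (Phi x) /\ Psi (Phi x) = x) /\
        (forall y, Y y -> U (Psi y) /\ Phi (Psi y) = y),
        injective L &
        forall x, U x -> (S x <-> range L (Phi x))].

(* Velocities at p of smooth curves in S. *)
Definition tangent V (S : set V) (p : V) : set V :=
  [set v : V | exists (e : R) (c : R -> V),
    [/\ 0 < e, smooth_in [set t | - e < t < e] c,
        forall t, - e < t < e -> S (c t), c 0 = p & 'D_1 c 0 = v]].

(* The restriction to S of the (globally smooth) map f is a submersion. *)
Definition submersion V W (S : set V) (f : V -> W) : Prop :=
  smooth_in setT f /\
  forall p, S p -> forall w, exists2 v, tangent S p v & 'd f p v = w.

End Smooth.

Section Families.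
Context (R : realType) (m : nat).

(* M(m; Lambda_delta) is identified, for every delta, with the vector space
   'M[R]_m * 'M[R]_m of pairs (real part, lambda part). *)
Definition to_mx (delta : R) (X : 'M[R]_m * 'M[R]_m) : 'M[Lam delta]_m :=
  \matrix_(i, j) MkLam (X.1 i j) (X.2 i j).

Definition of_mx (delta : R) (A : 'M[Lam delta]_m) : 'M[R]_m * 'M[R]_m :=
  (map_mx (@lre R delta) A, map_mx (@llam R delta) A).

Definition coords (delta : R) (G : set 'M[Lam delta]_m) :
  set ('M[R]_m * 'M[R]_m) := to_mx delta @^-1` G.

Definition subgroup_GL (delta : R) (G : set 'M[Lam delta]_m) : Prop :=
  [/\ G 1%:M, forall A B, G A -> G B -> G (A *m B) &
      forall A, G A -> A \in unitmx /\ G (invmx A)].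

Definition Lie_subgroup_GL (delta : R) (G : set 'M[Lam delta]_m) : Prop :=
  [/\ subgroup_GL G,
      exists k, submanifold k (coords G),
      smooth_on (coords G `*` coords G)
        (fun z => of_mx (to_mx delta z.1 *m to_mx delta z.2)) &
      smooth_on (coords G) (fun x => of_mx (invmx (to_mx delta x)))].

(* The total space M(m; Lambda_R), with projection [snd]. *)
Local Notation MR := ('M[R]_m * 'M[R]_m * R)%type.

Definition total (G : forall delta : R, set 'M[Lam delta]_m) : set MR :=
  [set z | G z.2 (to_mx z.2 z.1)].

(* Only meaningful for points x, y over the same parameter. *)
Definition total_mul (z : MR * MR) : MR :=
  (of_mx (to_mx z.1.2 z.1.1 *m to_mx z.1.2 z.2.1), z.1.2).

Definition total_inv (x : MR) : MR := (of_mx (invmx (to_mx x.2 x.1)), x.2).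

Definition total_one (delta : R) : MR :=
  (of_mx (1%:M : 'M[Lam delta]_m), delta).

Record one_parameter_family (G : forall delta : R, set 'M[Lam delta]_m) :
    Prop := OneParameterFamily {
  fiber_Lie : forall delta, Lie_subgroup_GL (G delta);
  total_submanifold : exists k, submanifold k (total G);
  proj_submersion : submersion (total G) (snd : MR -> R);
  mul_smooth :
    smooth_on [set z : MR * MR | [/\ total G z.1, total G z.2 & z.1.2 = z.2.2]]
      total_mul;
  inv_smooth : smooth_on (total G) total_inv;
  one_smooth : smooth_in setT total_one }.

Definition closed_subgroup (delta : R) (H G : set 'M[Lam delta]_m) : Prop :=
  H `<=` G /\ exists2 C, closed C & coords H = coords G `&` C.

Definition one_parameter_geometry
    (G H : forall delta : R, set 'M[Lam delta]_m) : Prop :=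
  [/\ one_parameter_family G, one_parameter_family H &
      forall delta, closed_subgroup (H delta) (G delta)].

End Families.

(* Main.v *)
Require Import Defs.
From HB Require Import structures.
From mathcomp Require Import all_boot all_order all_algebra.
From mathcomp Require Import all_classical all_reals all_analysis.
From mathcomp Require Import perm ring.

(** Both groups are instances of one construction: the matrices [A] with
    [star A *m A = 1], where [star A = Q A^dagger Q], that commute with a
    second diagonal sign matrix [P]. For [P = 1] this is the indefinite
    unitary group; for [P = Q] commutation forces the block form of the
    stabiliser. The family of these groups is smooth because the Cayley
    transform [cayley X = (1 - X) (1 + X)^-1], an involution where it is
    defined, turns the group into the linear equations [star X = - X] and
    [P X = X P] ([cayley_unitary], [isometries_cayley]), and these equations,
    written in the real and lambda coordinates, are the same for all delta
    ([lie_isometriesP]). So [(A, delta) |-> (cayley A, delta)] straightens the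
    total space wherever [1 + A] is invertible, without any inverse function
    theorem.

    Points where [1 + A] is singular are reached by translating with a
    diagonal sign matrix [D], which lies in the group over every delta: some
    [D] makes [1 + D A] invertible ([exists_sign_cayley]). Indeed the
    determinants [d = \det (1 + D A)] sum to [2 ^+ m] over all [D], while for
    an isometry [A] the elements [d] and [conj d] are associates, so that a
    non-invertible [d] has square zero and real part zero.

    Submersivity also comes from the chart: with the Cayley coordinate fixed
    and delta moving, one gets a curve in the total space with any prescribed
    velocity of delta. Multiplication is polynomial and inversion is [star] on
    the group. Smoothness of all these maps, in the sense of iterated
    differentials, reduces to real functions on open sets closed under sums,
    products and inverses, through the adjugate formula for matrix inverses. *)

Set Implicit Arguments.
Unset Strict Implicit.
Unset Printing Implicit Defensive.

Import Order.TTheory GRing.Theory Num.Theory.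
Import numFieldNormedType.Exports.

Local Open Scope classical_set_scope.
Local Open Scope ring_scope.

(** * Calculus on open sets *)

Section Calculus.
Context (R : realType).
Implicit Types V W : normedModType R.

(** A map vanishing near [x] is its own first-order expansion; this yields the
    locality of the differential in [eq_near_differentiable]. *)
Lemma is_diff_near0 V W (h : V -> W) (x : V) :
  (\near x, h x = 0) -> is_diff x h 0.
Proof.
move=> h0.
have hx0 : h x = 0 by exact: nbhs_singleton h0.
have E : h \o shift x = cst (h x) + \0 +o_ (0 : V) id.
  apply/eqaddoP => e e0.
  apply: filterS ((nbhs0P _ _).1 h0) => y; rewrite addrC => hy.
  rewrite !fctE /= hy hx0 addr0 subrr normr0 mulr_ge0//; exact: ltW.
have c0 : continuous (\0 : V -> W) by move=> y; exact: cst_continuous.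
have D : 'd h x = \0 :> (V -> W) by exact: (@diff_unique _ _ _ h).
by apply: DiffDef => //; apply/diff_locallyP; rewrite D.
Qed.

Lemma eq_near_differentiable V W (f g : V -> W) (x : V) :
  (\near x, f x = g x) -> differentiable f x ->
  differentiable g x /\ 'd g x = 'd f x :> (V -> W).
Proof.
move=> fg df.
have H : is_diff x (g - f) 0.
  apply: is_diff_near0; apply: filterS fg => y /= E.
  by rewrite -[LHS]/(g y - f y) E subrr.
have -> : g = f + (g - f) by rewrite addrC subrK.
split; first exact: differentiableD.
by rewrite diffD// [X in _ \+ X]diff_val; apply/funext => v /=; rewrite addr0.
Qed.

(** [Ck] speaks about ['d f] at the points of [U] only, but ['d f] depends on
    the germ of [f]; openness of [U] makes equality on [U] an equality of
    germs. Every rule below for a derivative computed on [U] goes through this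
    lemma. *)
Lemma Ck_congr k V W (U : set V) (f g : V -> W) :
  open U -> (forall x, U x -> f x = g x) -> Ck k U f -> Ck k U g.
Proof.
move=> oU; elim: k f g => [|k IH] f g fg /=.
  move=> cf x Ux; have Hx : f x = g x by exact: fg.
  have N : \near x, f x = g x.
    by apply: filterS (open_nbhs_nbhs (conj oU Ux)) => y /fg.
  by apply: cvg_trans (near_eq_cvg N) _; rewrite -Hx; exact: cf.
move=> [df ck].
have N x : U x -> \near x, f x = g x.
  by move=> Ux; apply: filterS (open_nbhs_nbhs (conj oU Ux)) => y /fg.
split=> [x Ux|v]; first by have [] := eq_near_differentiable (N x Ux) (df x Ux).
apply: IH (ck v) => x Ux.
by have [_ ->] := eq_near_differentiable (N x Ux) (df x Ux).
Qed.

Lemma Ck_le k V W (U : set V) (f : V -> W) : Ck k.+1 U f -> Ck k U f.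
Proof.
elim: k f => [|k IH] f [df ck].
  by move=> x /df; exact: differentiable_continuous.
by split=> // v; apply: IH; exact: ck.
Qed.

Lemma smooth_in_subset V W (U U' : set V) (f : V -> W) :
  U' `<=` U -> smooth_in U f -> smooth_in U' f.
Proof.
move=> sU sf k; move: f {sf}(sf k); elim: k => [|k IH] f /=.
  by move=> cf x /sU; exact: cf.
by move=> [df cf]; split=> [x /sU|v]; [exact: df|exact: IH].
Qed.

Lemma Ck_cst k V W (U : set V) (a : W) : Ck k U (fun=> a).
Proof.
elim: k a => [|k IH] a /=; first by move=> x _; exact: cst_continuous.
split=> [x _|v]; first exact: differentiable_cst.
rewrite (_ : (fun x => _) = fun=> 0); first exact: IH.
by apply/funext => x; rewrite diff_cst.
Qed.

Lemma smooth_cst V W (U : set V) (a : W) :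
  smooth_in U (fun=> a).
Proof. by move=> k; exact: Ck_cst. Qed.

Lemma Ck_linear k V W (U : set V) (f : V -> W) :
  linear f -> continuous f -> Ck k U f.
Proof.
move=> lf cf.
pose F : {linear V -> W} := HB.pack f (GRing.isLinear.Build _ _ _ _ _ lf).
case: k => [|k] /=; first by move=> x _; exact: cf.
split=> [x _|v]; first exact: (@linear_differentiable _ _ _ F).
rewrite (_ : (fun x => _) = fun=> f v); first exact: Ck_cst.
by apply/funext => x; rewrite (@diff_lin _ _ _ F).
Qed.

Lemma smooth_snd V W (U : set (V * W)) :
  smooth_in U (snd : V * W -> W).
Proof.
by move=> k; apply: Ck_linear => //; move=> x; exact: cvg_snd.
Qed.

Lemma Ck_comp_linear k V W W' (U : set V) (L : W -> W') (f : V -> W) :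
  open U -> linear L -> continuous L -> Ck k U f -> Ck k U (fun x => L (f x)).
Proof.
move=> oU lL cL.
pose F : {linear W -> W'} := HB.pack L (GRing.isLinear.Build _ _ _ _ _ lL).
elim: k f => [|k IH] f /=.
  move=> cf x Ux; apply: (@continuous_comp _ _ _ f L); [exact: cf|exact: cL].
move=> [df ck].
have dL y : differentiable L y by exact: (@linear_differentiable _ _ _ F).
split=> [x Ux|v].
  by apply: (@differentiable_comp _ _ _ _ f L); [exact: df|exact: dL].
apply: Ck_congr (IH _ (ck v)) => // x Ux.
rewrite (@diff_comp _ _ _ _ f L) //=; last exact: df.
by rewrite (@diff_lin _ _ _ F).
Qed.

Lemma CkD k V W (U : set V) (f g : V -> W) :
  open U -> Ck k U f -> Ck k U g -> Ck k U (fun x => f x + g x).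
Proof.
move=> oU; elim: k f g => [|k IH] f g /=.
  by move=> cf cg x Ux; apply: continuousD; [exact: cf|exact: cg].
move=> [df cf] [dg cg]; split=> [x Ux|v].
  by apply: differentiableD; [exact: df|exact: dg].
apply: Ck_congr (IH _ _ (cf v) (cg v)) => // x Ux.
by rewrite diffD//; [exact: df|exact: dg].
Qed.

Lemma Ck_pair k V W W' (U : set V) (f : V -> W) (g : V -> W') :
  open U -> Ck k U f -> Ck k U g -> Ck k U (fun x => (f x, g x)).
Proof.
move=> oU; elim: k f g => [|k IH] f g /=.
  by move=> cf cg x Ux; apply: cvg_pair; [exact: cf|exact: cg].
move=> [df cf] [dg cg]; split=> [x Ux|v].
  by apply: differentiable_pair; [exact: df|exact: dg].
apply: Ck_congr (IH _ _ (cf v) (cg v)) => // x Ux.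
by rewrite diff_pair//; [exact: df|exact: dg].
Qed.

(** The Leibniz rule multiplies a derivative by an undifferentiated factor, so
    the induction also uses that both factors are of class [k] themselves. *)
Lemma CkM k V (U : set V) (f g : V -> R) :
  open U -> Ck k U f -> Ck k U g -> Ck k U (fun x => f x * g x).
Proof.
move=> oU; elim: k f g => [|k IH] f g.
  by move=> cf cg x Ux; apply: continuousM; [exact: cf|exact: cg].
move=> cf cg; have cf' := Ck_le cf; have cg' := Ck_le cg.
case: cf => df cf; case: cg => dg cg; split=> [x Ux|v].
  by apply: differentiableM; [exact: df|exact: dg].
apply: Ck_congr (CkD oU (IH _ _ cf' (cg v)) (IH _ _ cg' (cf v))) => // x Ux.
by rewrite diffM//; [exact: df|exact: dg].
Qed.

(** By induction from the derivative [- f^-2 * 'd f], whose factors [f^-1] are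
    covered by the induction hypothesis. *)
Lemma CkV k V (U : set V) (f : V -> R) :
  open U -> (forall x, U x -> f x != 0) -> Ck k U f ->
  Ck k U (fun x => (f x)^-1).
Proof.
move=> oU f0; elim: k => [|k IH].
  by move=> cf x Ux; apply: continuousV; [exact: f0|exact: cf].
move=> cf; have cV := IH (Ck_le cf).
case: cf => df cf; split=> [x Ux|v].
  by apply: differentiableV; [exact: df|exact: f0].
have C := CkM oU (@Ck_cst k V R U (-1 : R)) (CkM oU (CkM oU cV cV) (cf v)).
apply: Ck_congr C => // x Ux.
rewrite diffV; [|exact: df|exact: f0].
by rewrite /= mulN1r -expr2 exprVn scaleNr.
Qed.

End Calculus.

(** * Smooth families of elements and matrices over the algebras *)

Section LamSmooth.
Context (R : realType) (V : normedModType R) (U : set V) (oU : open U).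
Context (delta : V -> R) (sdelta : smooth_in U delta).

(** The algebra [Lam (delta x)] in which [a x] lives varies with [x], so
    smoothness is that of the two real coordinates. The multiplication
    involves [delta x], hence needs [delta] smooth. *)
Definition lam_smooth (a : forall x, Lam (delta x)) : Prop :=
  smooth_in U (fun x => lre (a x)) /\ smooth_in U (fun x => llam (a x)).

Lemma eq_lam_smooth (a b : forall x, Lam (delta x)) :
  (forall x, U x -> a x = b x) -> lam_smooth a -> lam_smooth b.
Proof.
move=> ab [sa ta]; split=> k.
  by apply: Ck_congr (sa k) => // x /ab ->.
by apply: Ck_congr (ta k) => // x /ab ->.
Qed.

Lemma lam_smooth_real (r : R) : lam_smooth (fun x => MkLam r 0).
Proof. by split=> k; exact: Ck_cst. Qed.

Lemma lam_smoothD (a b : forall x, Lam (delta x)) :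
  lam_smooth a -> lam_smooth b -> lam_smooth (fun x => a x + b x).
Proof.
by move=> [sa ta] [sb tb]; split=> k; apply: CkD => //.
Qed.

Lemma lam_smoothM (a b : forall x, Lam (delta x)) :
  lam_smooth a -> lam_smooth b -> lam_smooth (fun x => a x * b x).
Proof.
move=> [sa ta] [sb tb]; split=> k; apply: CkD => //; apply: CkM => //.
by apply: CkM.
Qed.

Lemma lam_smoothN (a : forall x, Lam (delta x)) :
  lam_smooth a -> lam_smooth (fun x => - a x).
Proof.
move=> sa; apply: eq_lam_smooth (lam_smoothM (lam_smooth_real (-1)) sa) => x _.
by case: (a x) => r s; congr MkLam => /=; ring.
Qed.

Lemma lam_smooth_sum I (r : seq I) (P : pred I)
    (a : I -> forall x, Lam (delta x)) :
  (forall i, lam_smooth (a i)) ->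
  lam_smooth (fun x => \sum_(i <- r | P i) a i x).
Proof.
move=> sa; elim: r => [|i r IH].
  by apply: eq_lam_smooth (lam_smooth_real 0) => x _; rewrite big_nil.
case Pi : (P i).
  by apply: eq_lam_smooth (lam_smoothD (sa i) IH) => x _; rewrite big_cons Pi.
by apply: eq_lam_smooth IH => x _; rewrite big_cons Pi.
Qed.

Lemma lam_smooth_prod I (r : seq I) (P : pred I)
    (a : I -> forall x, Lam (delta x)) :
  (forall i, lam_smooth (a i)) ->
  lam_smooth (fun x => \prod_(i <- r | P i) a i x).
Proof.
move=> sa; elim: r => [|i r IH].
  by apply: eq_lam_smooth (lam_smooth_real 1) => x _; rewrite big_nil.
case Pi : (P i).
  by apply: eq_lam_smooth (lam_smoothM (sa i) IH) => x _; rewrite big_cons Pi.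
by apply: eq_lam_smooth IH => x _; rewrite big_cons Pi.
Qed.

Lemma lam_smooth_lnorm (a : forall x, Lam (delta x)) :
  lam_smooth a -> smooth_in U (fun x => lnorm (a x)).
Proof.
move=> [sa ta] k.
apply: Ck_congr (CkD oU (CkM oU (sa k) (sa k))
  (CkM oU (CkM oU (@Ck_cst R k V R U (-1 : R)) (sdelta k))
     (CkM oU (ta k) (ta k)))) => // x _.
by rewrite /lnorm; ring.
Qed.

Lemma lam_smoothV (a : forall x, Lam (delta x)) :
  (forall x, U x -> a x \is a GRing.unit) ->
  lam_smooth a -> lam_smooth (fun x => (a x)^-1).
Proof.
move=> ua sa; have sn := lam_smooth_lnorm sa.
have nz x : U x -> lnorm (a x) != 0 by move=> /ua.
case: sa => sa ta.
apply: (@eq_lam_smooth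
  (fun x => MkLam (lre (a x) / lnorm (a x)) (-1 * llam (a x) / lnorm (a x)))).
  by move=> x Ux; rewrite [RHS]/GRing.inv /= /Lam_inv ifT ?mulN1r//; exact: nz.
split=> k; apply: CkM => //; [exact: CkV| |exact: CkV].
by apply: CkM => //; exact: Ck_cst.
Qed.

Definition mx_smooth p q (M : forall x, 'M[Lam (delta x)]_(p, q)) : Prop :=
  forall i j, lam_smooth (fun x => M x i j).

Lemma mx_smooth_scalar p (r : R) :
  mx_smooth (fun x => ((MkLam r 0)%:M : 'M[Lam (delta x)]_p)).
Proof.
move=> i j; apply: (@eq_lam_smooth (fun x => MkLam (r *+ (i == j)) 0)).
  by move=> x _; rewrite mxE; case: eqP.
exact: lam_smooth_real.
Qed.

Lemma mx_smooth1 p : mx_smooth (fun x => (1%:M : 'M[Lam (delta x)]_p)).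
Proof. exact: mx_smooth_scalar. Qed.

Lemma mx_smoothD p q (M N : forall x, 'M[Lam (delta x)]_(p, q)) :
  mx_smooth M -> mx_smooth N -> mx_smooth (fun x => M x + N x).
Proof.
move=> sM sN i j.
by apply: eq_lam_smooth (lam_smoothD (sM i j) (sN i j)) => x _; rewrite mxE.
Qed.

Lemma mx_smoothN p q (M : forall x, 'M[Lam (delta x)]_(p, q)) :
  mx_smooth M -> mx_smooth (fun x => - M x).
Proof.
by move=> sM i j; apply: eq_lam_smooth (lam_smoothN (sM i j)) => x _; rewrite mxE.
Qed.

Lemma mx_smoothM p q r (M : forall x, 'M[Lam (delta x)]_(p, q))
    (N : forall x, 'M[Lam (delta x)]_(q, r)) :
  mx_smooth M -> mx_smooth N -> mx_smooth (fun x => M x *m N x).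
Proof.
move=> sM sN i j.
apply: eq_lam_smooth (lam_smooth_sum (index_enum _) xpredT
  (fun k => lam_smoothM (sM i k) (sN k j))) => x _.
by rewrite mxE.
Qed.

Lemma mx_smooth_det p (M : forall x, 'M[Lam (delta x)]_p) :
  mx_smooth M -> lam_smooth (fun x => \det (M x)).
Proof.
move=> sM; apply: lam_smooth_sum => s; apply: lam_smoothM.
  case: (perm.odd_perm s).
    apply: eq_lam_smooth (lam_smoothN (lam_smooth_real 1)) => x _.
    by rewrite expr1.
  by apply: eq_lam_smooth (lam_smooth_real 1) => x _; rewrite expr0.
by apply: lam_smooth_prod => i; exact: sM.
Qed.

Lemma mx_smooth_adjugate p (M : forall x, 'M[Lam (delta x)]_p) :
  mx_smooth M -> mx_smooth (fun x => \adj (M x)).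
Proof.
move=> sM i j.
apply: (@eq_lam_smooth (fun x => (-1) ^+ (j + i) *
  \det (row' j (col' i (M x))))) => [x _|]; first by rewrite mxE.
apply: lam_smoothM.
  elim: (j + i)%N => [|k IH]; first exact: lam_smooth_real 1.
  apply: eq_lam_smooth (lam_smoothN IH) => x _.
  by rewrite exprS mulN1r.
apply: mx_smooth_det => k l.
by apply: eq_lam_smooth (sM (lift j k) (lift i l)) => x _; rewrite !mxE.
Qed.

Lemma mx_smoothV p (M : forall x, 'M[Lam (delta x)]_p) :
  (forall x, U x -> M x \in unitmx) ->
  mx_smooth M -> mx_smooth (fun x => invmx (M x)).
Proof.
move=> uM sM i j.
apply: eq_lam_smooth (lam_smoothM (lam_smoothV _ (mx_smooth_det sM))
   (mx_smooth_adjugate sM i j)) => x Ux; last by have := uM x Ux.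
by rewrite /invmx uM// [RHS]mxE.
Qed.

Lemma mx_smooth_to_mx p (X : V -> 'M[R]_p * 'M[R]_p) :
  linear X -> continuous X -> mx_smooth (fun x => to_mx (delta x) (X x)).
Proof.
move=> lX cX i j; split=> k.
  apply: (@Ck_congr _ k _ _ U (fun x => (X x).1 i j)) => //.
    by move=> x _; rewrite mxE.
  apply: Ck_linear => [a u v|x]; first by rewrite lX !mxE.
  apply: (@continuous_comp _ _ _ (fun x => (X x).1) (fun A => A i j)).
    apply: (@continuous_comp _ _ _ X fst); first exact: cX.
    exact: cvg_fst.
  exact: coord_continuous.
apply: (@Ck_congr _ k _ _ U (fun x => (X x).2 i j)) => //.
  by move=> x _; rewrite mxE.
apply: Ck_linear => [a u v|x]; first by rewrite lX !mxE.
apply: (@continuous_comp _ _ _ (fun x => (X x).2) (fun A => A i j)).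
  apply: (@continuous_comp _ _ _ X snd); first exact: cX.
  exact: cvg_snd.
exact: coord_continuous.
Qed.

(** A matrix is the sum of its entries times the elementary matrices, which
    are fixed vectors. *)
Lemma smooth_matrix p q (N : V -> 'M[R]_(p, q)) :
  (forall i j, smooth_in U (fun x => N x i j)) -> smooth_in U N.
Proof.
move=> sN k.
have sum_smooth I (r : seq I) (F : I -> V -> 'M[R]_(p, q)) :
    (forall i, Ck k U (F i)) -> Ck k U (fun x => \sum_(i <- r) F i x).
  move=> sF; elim: r => [|i r IH].
    by apply: Ck_congr (@Ck_cst R k V _ U 0) => // x _; rewrite big_nil.
  by apply: Ck_congr (CkD oU (sF i) IH) => // x _; rewrite big_cons.
apply: (@Ck_congr _ k _ _ U (fun x => \sum_i \sum_j N x i j *: delta_mx i j)) => //.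
  by move=> x _; rewrite -matrix_sum_delta.
apply: (sum_smooth _ (index_enum _)) => i.
apply: (sum_smooth _ (index_enum _)) => j.
apply: (@Ck_comp_linear _ k _ R _ U (fun r => r *: delta_mx i j)) => //.
- by move=> a u v; rewrite scalerDl scalerA.
- exact: scalel_continuous.
- exact: sN.
Qed.

Lemma smooth_of_mx p (M : forall x, 'M[Lam (delta x)]_p) :
  mx_smooth M -> smooth_in U (fun x => of_mx (M x)).
Proof.
move=> sM k; apply: Ck_pair => //; apply: smooth_matrix => i j.
  by move=> l; apply: Ck_congr ((sM i j).1 l) => // x _; rewrite mxE.
by move=> l; apply: Ck_congr ((sM i j).2 l) => // x _; rewrite mxE.
Qed.

End LamSmooth.

Lemma mx_smooth_subset (R : realType) (V : normedModType R) (U U' : set V)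
    (delta : V -> R) p q (M : forall x, 'M[Lam (delta x)]_(p, q)) :
  U' `<=` U -> mx_smooth U M -> mx_smooth U' M.
Proof.
move=> sU sM i j; have [s t] := sM i j.
by split; apply: smooth_in_subset sU _.
Qed.

(** * Cayley transform and isometry groups *)

Section Cayley.
Context (T : comUnitRingType) (m : nat).
Implicit Types X P : 'M[T]_m.

(** The Cayley transform linearises a unitarity condition ([cayley_unitary])
    and is its own inverse ([cayleyK]), so it serves both as a chart and as
    the inverse of that chart. *)
Definition cayley X : 'M[T]_m := (1%:M - X) *m invmx (1%:M + X).

Lemma add1_cayley X : 1%:M + X \in unitmx ->
  1%:M + cayley X = 2 *: invmx (1%:M + X).
Proof.
move=> uX; rewrite /cayley -{1}(mulmxV uX) -mulmxDl.
have -> : 1%:M + X + (1%:M - X) = 2%:M by rewrite addrACA subrr addr0 -raddfD.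
by rewrite mul_scalar_mx.
Qed.

Context (two_unit : (2 : T) \is a GRing.unit).

Lemma cayley_dom X : 1%:M + X \in unitmx -> 1%:M + cayley X \in unitmx.
Proof. by move=> uX; rewrite add1_cayley// unitmxZ// unitmx_inv. Qed.

Lemma cayleyK X : 1%:M + X \in unitmx -> cayley (cayley X) = X.
Proof.
move=> uX; rewrite [LHS]/cayley [X in invmx X]add1_cayley// invmxZ ?unitmxZ ?unitmx_inv//.
rewrite invmxK.
have -> : 1%:M - cayley X = 2 *: (X *m invmx (1%:M + X)).
  rewrite -[in LHS](mulmxV uX) /cayley -mulmxBl scalemxAl; congr (_ *m _).
  by rewrite opprB addrC subrKA scaler_nat mulr2n.
by rewrite -scalemxAl -scalemxAr scalerA divrr// scale1r mulmxKV.
Qed.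

Lemma cayley_comm X P : 1%:M + X \in unitmx ->
  X *m P = P *m X -> cayley X *m P = P *m cayley X.
Proof.
move=> uX XP.
have E : invmx (1%:M + X) *m P = P *m invmx (1%:M + X).
  have PX : P *m (1%:M + X) = (1%:M + X) *m P.
    by rewrite mulmxDr mulmxDl mulmx1 mul1mx XP.
  by rewrite -[LHS](mulmxK uX) -(mulmxA _ P) PX mulKmx.
by rewrite /cayley -mulmxA E !mulmxA mulmxBl mulmxBr mul1mx mulmx1 XP.
Qed.

(** Multiplying [star (cayley X) + cayley X] by the units [1 + star X] on the
    left and [1 + X] on the right gives [2 (1 - star X *m X)]: the quadratic
    equation on [X] becomes a linear one on [cayley X]. *)
Lemma cayley_unitary (star : 'M[T]_m -> 'M[T]_m) X :
  star 1%:M = 1%:M -> {morph star : A B / A + B} -> {morph star : A / - A} ->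
  (forall A B, star (A *m B) = star B *m star A) ->
  1%:M + X \in unitmx ->
  star X *m X = 1%:M <-> star (cayley X) = - cayley X.
Proof.
move=> s1 sD sN sM uX.
set B := invmx (1%:M + X).
have sB1 : (1%:M + star X) *m star B = 1%:M.
  by rewrite -[in X in X + _]s1 -sD -sM mulVmx.
have sB2 : star B *m (1%:M + star X) = 1%:M.
  by rewrite -[in X in X + _]s1 -sD -sM mulmxV.
have E : (1%:M + star X) *m (star (cayley X) + cayley X) *m (1%:M + X) =
    2 *: (1%:M - star X *m X).
  have H1 : (1%:M + star X) *m star (cayley X) = 1%:M - star X.
    by rewrite /cayley sM mulmxA sB1 mul1mx sD sN s1.
  have H2 : cayley X *m (1%:M + X) = 1%:M - X by rewrite mulmxKV.
  rewrite (mulmxDr (1%:M + star X) (star _)) H1 mulmxDl -(mulmxA _ (cayley X)) H2.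
  rewrite !(mulmxDl, mulmxDr, mulmxN, mulNmx) !mul1mx !mulmx1.
  rewrite scaler_nat mulr2n; move: (star X *m X) (star X) => S s.
  rewrite addrACA (addrACA _ X) (addrACA (- s)) subrr addNr addr0 add0r.
  by rewrite [RHS]addrACA.
split=> H.
  rewrite H subrr scaler0 in E; apply/eqP; rewrite -addr_eq0; apply/eqP.
  have := congr1 (fun Z => star B *m Z *m B) E.
  by rewrite !mulmxA sB2 mul1mx mulmx0 mul0mx -mulmxA mulmxV// mulmx1.
move: E; rewrite H addNr mulmx0 mul0mx => /esym/(congr1 (fun Z => 2^-1 *: Z)).
rewrite scalerA mulVr// scale1r scaler0 => /eqP.
by rewrite subr_eq0 => /eqP.
Qed.

End Cayley.

Section Signs.
Context (T : comUnitRingType) (m : nat).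

Definition sgmx (q : 'I_m -> bool) : 'M[T]_m := diag_mx (\row_i (-1) ^+ q i).

Lemma mul_sgmx q p (A : 'M[T]_(m, p)) i j :
  (sgmx q *m A) i j = (-1) ^+ q i * A i j.
Proof. by rewrite mul_diag_mx !mxE. Qed.

Lemma mulmx_sgmx q p (A : 'M[T]_(p, m)) i j :
  (A *m sgmx q) i j = A i j * (-1) ^+ q j.
Proof. by rewrite mul_mx_diag !mxE. Qed.

Lemma sgmxK q : sgmx q *m sgmx q = 1%:M.
Proof.
apply/matrixP => i j; rewrite mul_sgmx !mxE; case: eqP => [->|_].
  by rewrite mulr1n -expr2 sqrr_sign.
by rewrite mulr0n mulr0.
Qed.

Lemma sgmxC q p : sgmx q *m sgmx p = sgmx p *m sgmx q.
Proof. exact: diag_mxC. Qed.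

Lemma sgmx_false : sgmx (fun=> false) = 1%:M :> 'M[T]_m.
Proof.
by apply/matrixP => i j; rewrite !mxE expr0; case: eqP.
Qed.

(** Averaging over the signs kills every term of the expansion in the rows of
    [sgmx e *m A] except the constant one. So the determinants cannot all lie
    in an additive subgroup that misses [2 ^+ m]. *)
Lemma sum_det_sgmx (A : 'M[T]_m) :
  \sum_(e : {ffun 'I_m -> bool}) \det (1%:M + sgmx e *m A) = 2 ^+ m.
Proof.
rewrite -det_scalar /determinant exchange_big /=; apply: eq_bigr => s _.
rewrite -big_distrr /=; congr (_ * _).
transitivity (\sum_(e : {ffun 'I_m -> bool}) \prod_i
   ((1%:M : 'M[T]_m) i (s i) + (-1) ^+ e i * A i (s i))).
  by apply: eq_bigr => e _; apply: eq_bigr => i _; rewrite mxE mul_sgmx.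
rewrite -(bigA_distr_bigA (fun i (b : bool) =>
   (1%:M : 'M[T]_m) i (s i) + (-1) ^+ b * A i (s i))).
apply: eq_bigr => i _; rewrite big_bool /= expr1 expr0 mulN1r mul1r.
rewrite addrACA addNr addr0 !mxE.
by case: eqP => _; rewrite ?mulr0n ?addr0// mulr1n.
Qed.

End Signs.
Arguments sgmx {T m} q.

Section Isometries.
Context (T : comUnitRingType) (conj : {rmorphism T -> T}) (m : nat).
Implicit Types (A B X : 'M[T]_m) (q p e : 'I_m -> bool).

(** The adjoint for the Hermitian form with diagonal matrix [sgmx q]. *)
Definition star q A : 'M[T]_m := sgmx q *m (map_mx conj A)^T *m sgmx q.

Lemma starE q A i j :
  star q A i j = (-1) ^+ q i * conj (A j i) * (-1) ^+ q j.
Proof. by rewrite mulmx_sgmx mul_sgmx !mxE. Qed.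

Lemma star1 q : star q 1%:M = 1%:M.
Proof. by rewrite /star map_mx1 trmx1 mulmx1 sgmxK. Qed.

Lemma starD q : {morph star q : A B / A + B}.
Proof. by move=> A B; rewrite /star map_mxD raddfD /= mulmxDr mulmxDl. Qed.

Lemma starN q : {morph star q : A / - A}.
Proof. by move=> A; rewrite /star map_mxN raddfN /= mulmxN mulNmx. Qed.

Lemma starM q A B : star q (A *m B) = star q B *m star q A.
Proof.
rewrite /star map_mxM trmx_mul !mulmxA.
by rewrite -(mulmxA (_ *m (map_mx conj B)^T) (sgmx q)) sgmxK mulmx1.
Qed.

Lemma star_sgmx q e : star q (sgmx e) = sgmx e.
Proof.
apply/matrixP => i j; rewrite starE !mxE eq_sym; case: eqP => [->|_].
  by rewrite mulr1n rmorph_sign mulrAC -expr2 sqrr_sign mul1r.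
by rewrite mulr0n rmorph0 mulr0 mul0r.
Qed.

Lemma det_star q A : \det (star q A) = conj (\det A).
Proof.
rewrite /star !det_mulmx mulrAC -det_mulmx sgmxK det1 mul1r.
by rewrite det_tr det_map_mx.
Qed.

(** Since [A] has inverse [star q A], the adjoint of [1 + sgmx e *m A] becomes
    [sgmx e *m (1 + sgmx e *m A)] after multiplication by [A] on the left:
    [conj d] and [d] are associates for [d] the determinant. *)
Lemma det_sign_star q e A : star q A *m A = 1%:M ->
  \det A * conj (\det (1%:M + sgmx e *m A)) =
  \det (sgmx e) * \det (1%:M + sgmx e *m A).
Proof.
move=> /mulmx1C AsA.
rewrite -(det_star q) -!det_mulmx starD starM star_sgmx star1; congr (\det _).
by rewrite !mulmxDr !mulmx1 (mulmxA A) AsA (mulmxA (sgmx e)) sgmxK !mul1mx addrC.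
Qed.

(** Isometries of the form [sgmx q] that preserve the two eigenspaces of
    [sgmx p]. The choice [p = fun=> false] gives the full isometry group; when
    [q] singles out the last coordinate, [p = q] gives the stabiliser of the
    last coordinate line. *)
Definition isometries q p : set 'M[T]_m :=
  [set A | star q A *m A = 1%:M /\ A *m sgmx p = sgmx p *m A].

Lemma isometries1 q p : isometries q p 1%:M.
Proof. by split; rewrite ?star1 ?mul1mx// mulmx1. Qed.

Lemma isometriesM q p A B :
  isometries q p A -> isometries q p B -> isometries q p (A *m B).
Proof.
move=> [A1 AP] [B1 BP]; split.
  by rewrite starM -mulmxA (mulmxA _ A) A1 mul1mx.
by rewrite -mulmxA BP mulmxA AP mulmxA.
Qed.

Lemma isometries_sgmx q p e : isometries q p (sgmx e).
Proof. by split; [rewrite star_sgmx sgmxK|exact: sgmxC]. Qed.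

Lemma isometries_sgmxM q p e A :
  isometries q p (sgmx e *m A) <-> isometries q p A.
Proof.
split=> [H|]; last by apply: isometriesM; exact: isometries_sgmx.
by rewrite -[A]mul1mx -(sgmxK _ e) -mulmxA;
  apply: isometriesM H; exact: isometries_sgmx.
Qed.

Lemma isometries_inv q p A : isometries q p A ->
  [/\ A \in unitmx, invmx A = star q A & isometries q p (invmx A)].
Proof.
move=> [A1 AP]; have [_ uA] := mulmx1_unit A1.
have E : invmx A = star q A by rewrite -[RHS](mulmxK uA) A1 mul1mx.
split=> //; split.
  by rewrite E -starM -E mulmxV// star1.
by rewrite -[LHS](mulmxK uA) -(mulmxA _ (sgmx p)) -AP mulKmx.
Qed.

Lemma isometries_commute q p A :
  isometries q p A <->
  isometries q (fun=> false) A /\ A *m sgmx p = sgmx p *m A.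
Proof.
split=> [[A1 AP]|[[A1 _] AP]]; split=> //; split=> //.
by rewrite sgmx_false mul1mx mulmx1.
Qed.

(** The Lie algebra of [isometries q p]. *)
Definition lie_isometries q p : set 'M[T]_m :=
  [set X | star q X = - X /\ X *m sgmx p = sgmx p *m X].

Lemma isometries_cayley q p A :
  (2 : T) \is a GRing.unit -> 1%:M + A \in unitmx ->
  isometries q p A <-> lie_isometries q p (cayley A).
Proof.
move=> two uA.
have C := cayley_unitary two (star1 q) (@starD q) (@starN q) (@starM q) uA.
split=> -[s c]; split; [exact/C|exact: cayley_comm|exact/C|].
by rewrite -(cayleyK two uA); apply: cayley_comm => //; exact: cayley_dom.
Qed.

End Isometries.

Section LamAlgebra.
Context (R : realType) (delta : R).
Implicit Types x y : Lam delta.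

Lemma lconjM x y : lconj (x * y) = lconj x * lconj y.
Proof. by congr MkLam => /=; ring. Qed.

Lemma lconj1 : lconj 1 = 1 :> Lam delta.
Proof. by congr MkLam => /=; ring. Qed.

Fact lconj_zmod_morphism : zmod_morphism (@lconj R delta).
Proof. by move=> x y; congr MkLam => /=; ring. Qed.
HB.instance Definition _ := GRing.isZmodMorphism.Build (Lam delta) (Lam delta)
  (@lconj R delta) lconj_zmod_morphism.
Fact lconj_monoid_morphism : monoid_morphism (@lconj R delta).
Proof. by split; [exact: lconj1|exact: lconjM]. Qed.
HB.instance Definition _ := GRing.isMonoidMorphism.Build (Lam delta) (Lam delta)
  (@lconj R delta) lconj_monoid_morphism.

Lemma Lam_unitE x : (x \is a GRing.unit) = (lnorm x != 0).
Proof. by []. Qed.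

Lemma lre_nat k : lre (k%:R : Lam delta) = k%:R.
Proof. by elim: k => [|k IH] //; rewrite !mulrS /= IH. Qed.

Lemma Lam_nat k : (k%:R : Lam delta) = MkLam k%:R 0.
Proof.
elim: k => [|k IH] //; rewrite !mulrS IH; by congr MkLam; rewrite /= addr0.
Qed.

Lemma Lam_two_unit : (2 : Lam delta) \is a GRing.unit.
Proof.
rewrite Lam_unitE Lam_nat /lnorm /= expr0n mulr0 subr0.
by rewrite expf_neq0// pnatr_eq0.
Qed.

Lemma lre_sum I (r : seq I) (F : I -> Lam delta) :
  lre (\sum_(i <- r) F i) = \sum_(i <- r) lre (F i).
Proof. by elim: r => [|i r IH]; rewrite ?big_nil// !big_cons /= IH. Qed.

(** The real part of [x * x] and [lnorm x] add up to [2 * lre x ^+ 2],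
    whatever the sign of [delta]. The conclusion, unlike the hypotheses, is
    stable under sums of elements. *)
Lemma Lam_sqr0 x : x * x = 0 -> lnorm x = 0 -> lre x = 0.
Proof.
case: x => a b; rewrite /lnorm /= => -[E _] N.
apply/eqP; rewrite -sqrf_eq0; apply/eqP.
have : 2 * a ^+ 2 = 0 by rewrite -[RHS]addr0 -{1}E -N; ring.
by move=> /eqP; rewrite mulf_eq0 pnatr_eq0 /= => /eqP.
Qed.

Context (m : nat).
Implicit Types A : 'M[Lam delta]_m.
Local Notation star := (star (@lconj R delta)).
Local Notation isometries := (isometries (@lconj R delta)).

(** If no sign matrix worked, each determinant [d] would satisfy
    [d * conj d = 0], hence [d * d = 0] because [conj d] and [d] are
    associates, hence [lre d = 0]; but these determinants add up to [2 ^+ m].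
    The argument covers the field ([delta < 0]), dual number ([delta = 0]) and
    split ([delta > 0]) cases at once. *)
Lemma exists_sign_cayley q A : star q A *m A = 1%:M ->
  exists e : {ffun 'I_m -> bool}, 1%:M + sgmx e *m A \in unitmx.
Proof.
move=> sAA; apply: contrapT => /forallNP H.
have z (e : {ffun 'I_m -> bool}) : lre (\det (1%:M + sgmx e *m A)) = 0.
  have := det_sign_star e sAA; move: (H e); rewrite unitmxE.
  move: (\det _) (\det A) => d a.
  rewrite Lam_unitE => /negP; rewrite negbK => /eqP nd Ad.
  apply: Lam_sqr0 => //.
  have dd : d * lconj d = 0 by rewrite mul_lconj nd.
  have : \det (sgmx e) * (\det (sgmx e) * (d * d)) = 0 :> Lam delta.
    by rewrite [X in _ * X]mulrA -Ad -mulrA (mulrC (lconj d)) dd !mulr0.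
  by rewrite mulrA -det_mulmx sgmxK det1 mul1r.
have := congr1 (@lre R delta) (sum_det_sgmx A).
rewrite lre_sum big1 => [|e _]; last exact: z.
rewrite -natrX lre_nat => /esym/eqP.
by rewrite pnatr_eq0 expn_eq0.
Qed.

Lemma isometries_subgroup (q p : 'I_m -> bool) : subgroup_GL (isometries q p).
Proof.
split=> [|A B|A /isometries_inv[]//]; [exact: isometries1|exact: isometriesM].
Qed.

End LamAlgebra.

(** * Slice charts *)

Lemma kernel_coordinates (F : fieldType) (W W' : vectType F) (f : W -> W') :
  linear f ->
  exists k (L : {linear 'rV[F]_k -> W}),
    injective L /\ forall x, f x = 0 <-> exists u, L u = x.
Proof.
move=> lf.
pose g : {linear W -> W'} := HB.pack f (GRing.isLinear.Build _ _ _ _ _ lf).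
pose K := lker (linfun g).
pose h (u : 'rV[F]_(\dim K)) : W := \sum_i u 0 i *: (vbasis K)`_i.
have lh : linear h.
  move=> a u v; rewrite /h scaler_sumr -big_split; apply: eq_bigr => i _ /=.
  by rewrite !mxE scalerDl scalerA.
pose L : {linear 'rV[F]_(\dim K) -> W} :=
  HB.pack h (GRing.isLinear.Build _ _ _ _ _ lh).
exists (\dim K), L; split.
  move=> u v /= E; apply/rowP => i.
  have fK : free (vbasis K) by exact: basis_free (vbasisP K).
  by have := congr1 (coord (vbasis K) i) E; rewrite !coord_sum_free.
move=> x; have -> : f x = 0 <-> x \in K.
  by rewrite memv_ker lfunE /=; split=> [->|/eqP].
split=> [xK|[u <-]].
  exists (\row_i coord (vbasis K) i x).
  rewrite [RHS](coord_vbasis xK); apply: eq_bigr => i _.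
  by rewrite mxE.
apply: memv_suml => i _; apply: memvZ; apply: vbasis_mem.
by rewrite mem_nth// size_tuple.
Qed.

Section Coordinates.
Context (R : realType) (m : nat).
Local Notation MM := ('M[R]_m * 'M[R]_m)%type.

Lemma of_mxK (delta : R) : cancel (@of_mx R m delta) (to_mx delta).
Proof.
by move=> A; apply/matrixP => i j; rewrite !mxE; case: (A i j).
Qed.

Lemma to_mxK (delta : R) : cancel (to_mx delta) (@of_mx R m delta).
Proof.
by move=> [X1 X2]; congr pair; apply/matrixP => i j; rewrite !mxE.
Qed.

Lemma to_mx0 (delta : R) : to_mx delta (0 : MM) = 0.
Proof. by apply/matrixP => i j; rewrite !mxE. Qed.

(** Real equations of the Lie algebra in coordinates. The conjugation negates
    the lambda part, so [lie_isometries] asks it to be self-adjoint and the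
    real part to be skew for the real form; no equation involves [delta]. *)
Definition lie_defect (q p : 'I_m -> bool) (z : MM) : MM * MM :=
  ((z.1 + sgmx q *m z.1^T *m sgmx q, z.2 - sgmx q *m z.2^T *m sgmx q),
   (z.1 *m sgmx p - sgmx p *m z.1, z.2 *m sgmx p - sgmx p *m z.2)).

Lemma lie_defect_linear q p : linear (lie_defect q p).
Proof.
move=> a z w; rewrite /lie_defect /=.
congr ((_, _), (_, _)); apply/matrixP => i j;
  rewrite !(mulmx_sgmx, mul_sgmx, mxE) /=; ring.
Qed.

(** The Lie algebras of all fibres are the same subspace of the coordinate
    space. This is what makes the union of the fibres a smooth family. *)
Lemma lie_isometriesP (delta : R) (q p : 'I_m -> bool) (z : MM) :
  lie_isometries (@lconj R delta) q p (to_mx delta z) <-> lie_defect q p z = 0.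
Proof.
have s (b : bool) : ((-1) ^+ b : Lam delta) = MkLam ((-1) ^+ b) 0.
  by case: b; [rewrite !expr1; congr MkLam; rewrite /= oppr0|rewrite !expr0].
have E1 : to_mx delta z + star (@lconj R delta) q (to_mx delta z) =
          to_mx delta (lie_defect q p z).1.
  apply/matrixP => i j; rewrite mxE starE !(mulmx_sgmx, mul_sgmx, mxE) !s.
  by congr MkLam => /=; ring.
have E2 : to_mx delta z *m sgmx p - sgmx p *m to_mx delta z =
          to_mx delta (lie_defect q p z).2.
  apply/matrixP => i j; rewrite [LHS]mxE [X in _ + X]mxE.
  rewrite !(mulmx_sgmx, mul_sgmx, mxE) !s.
  by congr MkLam => /=; ring.
split=> [[sz cz]|dz].
  have F1 : (lie_defect q p z).1 = 0.
    by rewrite -[LHS](to_mxK delta) -E1 sz subrr -(to_mx0 delta) to_mxK.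
  have F2 : (lie_defect q p z).2 = 0.
    by rewrite -[LHS](to_mxK delta) -E2 cz subrr -(to_mx0 delta) to_mxK.
  by rewrite [LHS]surjective_pairing F1 F2.
move: E1 E2; rewrite dz /= to_mx0 => E1 E2; split.
  by apply/eqP; rewrite -addr_eq0 addrC E1.
by apply/eqP; rewrite -subr_eq0 E2.
Qed.

End Coordinates.

Section CayleySmooth.
Context (R : realType) (V : normedModType R) (U : set V) (oU : open U).
Context (delta : V -> R) (sdelta : smooth_in U delta) (m : nat).

Lemma mx_smooth_sgmx q : mx_smooth U (fun x => (sgmx q : 'M[Lam (delta x)]_m)).
Proof.
move=> i j; apply: (@eq_lam_smooth _ _ _ oU _
   (fun x => MkLam ((-1) ^+ q i *+ (i == j)) 0)); last exact: lam_smooth_real.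
move=> x _; rewrite !mxE; case: (i == j); rewrite ?mulr0n// mulr1n.
by case: (q i); rewrite ?expr0// expr1; congr MkLam; rewrite /= oppr0.
Qed.

Lemma mx_smooth_star q (M : forall x, 'M[Lam (delta x)]_m) :
  mx_smooth U M -> mx_smooth U (fun x => star (@lconj R (delta x)) q (M x)).
Proof.
move=> sM; apply: mx_smoothM => //; last exact: mx_smooth_sgmx.
apply: mx_smoothM => //; first exact: mx_smooth_sgmx.
move=> i j; have [s t] := sM j i; split=> k.
  by apply: Ck_congr (s k) => // x _; rewrite !mxE.
apply: Ck_congr (CkM oU (@Ck_cst R k V R U (-1 : R)) (t k)) => // x _.
by rewrite !mxE mulN1r.
Qed.

Lemma mx_smooth_cayley (M : forall x, 'M[Lam (delta x)]_m) :
  (forall x, U x -> 1%:M + M x \in unitmx) ->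
  mx_smooth U M -> mx_smooth U (fun x => cayley (M x)).
Proof.
move=> uM sM; apply: mx_smoothM => //.
  apply: mx_smoothD => //; first exact: mx_smooth1.
  exact: mx_smoothN.
apply: mx_smoothV => //; apply: mx_smoothD => //; exact: mx_smooth1.
Qed.

End CayleySmooth.

(** Invertibility is the non-vanishing of the real smooth function
    [lnorm \o \det]. *)
Lemma open_unitmx (R : realType) (V : normedModType R) (delta : V -> R) m
    (M : forall x, 'M[Lam (delta x)]_m) :
  smooth_in setT delta -> mx_smooth setT M -> open [set x | M x \in unitmx].
Proof.
move=> sd sM.
rewrite (_ : mkset _ = (fun x => lnorm (\det (M x))) @^-1` [set r | r != 0]).
  apply: open_comp; last exact: open_neq.
  move=> x _; have := lam_smooth_lnorm openT sd (mx_smooth_det openT sd sM).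
  by move=> /(_ 0%N x I).
by apply/funext => x /=; rewrite unitmxE Lam_unitE.
Qed.

Section Charts.
Context (R : realType) (m : nat) (q p : 'I_m -> bool).
Local Notation MM := ('M[R]_m * 'M[R]_m)%type.
(* [V] stands for a single fibre or for the total space; [delta] and [X] are the
   parameter and the matrix of a point, [mk x z] replaces the matrix of [x] by
   [z] over the same parameter. *)
Context (V : normedModType R) (delta : V -> R) (X : V -> MM)
  (mk : V -> MM -> V).
Hypotheses (sdelta : smooth_in setT delta) (lX : linear X) (cX : continuous X).
Hypotheses (delta_mk : forall x z, delta (mk x z) = delta x)
  (X_mk : forall x z, X (mk x z) = z) (mk_X : forall x, mk x (X x) = x)
  (mk_mk : forall x z w, mk (mk x z) w = mk x w).
Hypothesis smooth_mk : forall (U : set V) (F : V -> MM),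
  open U -> smooth_in U F -> smooth_in U (fun x => mk x (F x)).

Let A x := to_mx (delta x) (X x).

(** Near [x0] the slice chart is [x |-> cayley (D *m A x)] with the parameter
    kept, where the sign matrix [D], a point of the group over every
    parameter, is chosen so that the chart is defined at [x0]; its inverse is
    [y |-> D *m cayley (A y)]. *)
Lemma cayley_submanifold k (L : {linear 'rV[R]_k -> V}) :
  injective L ->
  (forall x, lie_defect q p (X x) = 0 <-> exists u, L u = x) ->
  submanifold k [set x | isometries (@lconj R (delta x)) q p (A x)].
Proof.
move=> iL rL x0 /= Sx0.
have [e ue] := exists_sign_cayley Sx0.1.
have sA : mx_smooth setT A by exact: (mx_smooth_to_mx openT).
have sDA : mx_smooth setT (fun x => sgmx e *m A x).
  by apply: (mx_smoothM openT sdelta) => //; exact: (mx_smooth_sgmx openT).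
have sub U : smooth_in U delta by exact: (smooth_in_subset (@subsetT _ U)).
have subm (U : set V) (M : forall x, 'M[Lam (delta x)]_m) :
  mx_smooth setT M -> mx_smooth U M by exact: mx_smooth_subset.
pose U := [set x | 1%:M + sgmx e *m A x \in unitmx].
pose Y := [set x | 1%:M + A x \in unitmx].
have oU : open U.
  apply: open_unitmx => //; apply: (mx_smoothD openT) => //.
  exact: (mx_smooth1 openT).
have oY : open Y.
  apply: open_unitmx => //; apply: (mx_smoothD openT) => //.
  exact: (mx_smooth1 openT).
pose Phi x := mk x (of_mx (cayley (sgmx e *m A x))).
pose Psi x := mk x (of_mx (sgmx e *m cayley (A x))).
have two x : (2 : Lam (delta x)) \is a GRing.unit by exact: Lam_two_unit.
have sPhi : smooth_in U Phi.
  apply: (smooth_mk oU); apply: (smooth_of_mx oU).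
  exact: (mx_smooth_cayley oU (sub U) (fun x ux => ux) (subm U _ sDA)).
have sPsi : smooth_in Y Psi.
  apply: (smooth_mk oY); apply: (smooth_of_mx oY).
  apply: (mx_smoothM oY (sub Y) (mx_smooth_sgmx oY delta e)).
  exact: (mx_smooth_cayley oY (sub Y) (fun x ux => ux) (subm Y _ sA)).
have uU : U x0 by exact: ue.
exists U, Y, Phi, Psi, L; split=> [|||//|].
- by split.
- by split.
- split=> x ux.
    split.
      rewrite /Y /A /Phi /= delta_mk X_mk of_mxK; exact: (cayley_dom (two x) ux).
    rewrite /Psi /Phi mk_mk /A delta_mk X_mk of_mxK (cayleyK (two x) ux) mulmxA sgmxK.
    by rewrite mul1mx to_mxK.
  split.
    rewrite /U /A /Psi /= delta_mk X_mk of_mxK mulmxA sgmxK mul1mx.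
    exact: (cayley_dom (two x) ux).
  rewrite /Psi /Phi mk_mk /A delta_mk X_mk of_mxK mulmxA sgmxK mul1mx.
  by rewrite (cayleyK (two x) ux) to_mxK.
- move=> x ux.
  have := rL (Phi x); rewrite X_mk -(lie_isometriesP (delta x)) of_mxK => H.
  have C := isometries_cayley (@lconj R (delta x)) q p (two x) ux.
  split=> [Sx|[u _ E]].
    have /C/H[u E] : isometries (@lconj R (delta x)) q p (sgmx e *m A x).
      exact: (isometries_sgmxM _ q p e (A x)).2 Sx.
    by exists u.
  have /C cS : lie_isometries (@lconj R (delta x)) q p (cayley (sgmx e *m A x)).
    by apply/H; exists u.
  exact: (isometries_sgmxM _ q p e (A x)).1 cS.
Qed.

End Charts.

(** * Families of isometry groups *)

Section Family.
Context (R : realType) (m : nat) (q p : 'I_m -> bool).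
Local Notation MM := ('M[R]_m * 'M[R]_m)%type.
Local Notation G := (fun delta : R => isometries (@lconj R delta) q p).

Lemma isometries_fiber_submanifold (delta : R) :
  exists k, submanifold k (coords (G delta)).
Proof.
have [k [L [iL rL]]] := kernel_coordinates (@lie_defect_linear R m q p).
exists k.
apply: (@cayley_submanifold R m q p MM (fun=> delta) id (fun _ z => z)
  _ _ _ _ _ _ _ _ k L iL rL) => //.
- exact: smooth_cst.
- by move=> x; exact: cvg_id.
Qed.

Lemma isometries_total_submanifold : exists k, submanifold k (Defs.total G).
Proof.
(* [R^o] carries the finite-dimensional structure of the parameter line. *)
pose f (x : MM * R^o) := lie_defect q p x.1.
have lf : linear f by move=> a x y; rewrite /f -lie_defect_linear.
have [k [L [iL rL]]] := kernel_coordinates lf.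
exists k.
apply: (@cayley_submanifold R m q p (MM * R)%type snd fst (fun x z => (z, x.2))
  _ _ _ _ _ _ _ _ k L iL rL) => //.
- exact: smooth_snd.
- by move=> x; exact: cvg_fst.
- by case.
- move=> U F oU sF l; apply: (Ck_pair oU (sF l)).
  exact: smooth_snd.
Qed.

Lemma isometries_fiber_Lie (delta : R) : Lie_subgroup_GL (G delta).
Proof.
split; [exact: isometries_subgroup|exact: isometries_fiber_submanifold| |].
  move=> z _; exists setT, (fun z => of_mx (to_mx delta z.1 *m to_mx delta z.2)).
  split=> //; first exact: openT.
  have sd : smooth_in setT (fun _ : MM * MM => delta) by exact: smooth_cst.
  apply: (smooth_of_mx openT (delta := fun=> delta)).
  apply: (mx_smoothM openT sd).
    by apply: (@mx_smooth_to_mx _ _ _ openT (fun=> delta) _ fst) => // x;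
      exact: cvg_fst.
  by apply: (@mx_smooth_to_mx _ _ _ openT (fun=> delta) _ snd) => // x;
      exact: cvg_snd.
move=> z _.
exists setT, (fun z => of_mx (star (@lconj R delta) q (to_mx delta z))).
have sd : smooth_in setT (fun _ : MM => delta) by exact: smooth_cst.
split=> //; first exact: openT.
  apply: (smooth_of_mx openT (delta := fun=> delta)).
  apply: (mx_smooth_star openT sd).
  by apply: (@mx_smooth_to_mx _ _ _ openT (fun=> delta) _ id) => // x;
    exact: cvg_id.
by move=> x _ /isometries_inv[_ -> _].
Qed.

(** With [X] the image of the given point in the Cayley chart, the points
    [D *m cayley X] computed over the parameters [d + w * t] form a curve in
    the total space, because [X] satisfies the equations of the Lie algebra
    over every parameter. *)
Lemma isometries_submersion : submersion (Defs.total G) (snd : MM * R -> R).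
Proof.
split; first exact: smooth_snd.
move=> [z d] /= Sz w.
have [e ue] := exists_sign_cayley Sz.1.
pose d_ (t : R) := d + w * t.
pose X := cayley (sgmx e *m to_mx d z).
have sd (U : set R) : open U -> smooth_in U d_.
  move=> oU k; apply: CkD => //; first exact: Ck_cst.
  apply: CkM => //; first exact: Ck_cst.
  by apply: (@Ck_linear _ _ _ _ _ id) => // x;
    exact: cvg_id.
pose A t := to_mx (d_ t) (of_mx X).
have two t : (2 : Lam (d_ t)) \is a GRing.unit by exact: Lam_two_unit.
have sA (U : set R) : open U -> mx_smooth U A.
  move=> oU i j; split=> k.
    by apply: Ck_congr (@Ck_cst R k R R U ((of_mx X).1 i j)) => // t _;
      rewrite [in RHS]/A [in RHS]mxE.
  by apply: Ck_congr (@Ck_cst R k R R U ((of_mx X).2 i j)) => // t _;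
      rewrite [in RHS]/A [in RHS]mxE.
have d0 : d_ 0 = d by rewrite /d_ mulr0 addr0.
have oY : open [set t | 1%:M + A t \in unitmx].
  apply: (open_unitmx (sd _ openT)).
  apply: (mx_smoothD openT) => //; first exact: (mx_smooth1 openT).
  exact: (sA _ openT).
have Y0 : [set t | 1%:M + A t \in unitmx] 0.
  by rewrite /= /A d0 of_mxK cayley_dom// Lam_two_unit.
have /nbhs_ballP[eps /= eps0 epsY] := open_nbhs_nbhs (conj oY Y0).
pose I := [set t : R | - eps < t < eps].
have IY t : I t -> 1%:M + A t \in unitmx.
  move=> It; apply: epsY; rewrite /ball /= sub0r normrN ltr_norml.
  exact: It.
have oI : open I.
  rewrite (_ : I = ball (0 : R) eps); first exact: ball_open.
  by apply/funext => t; rewrite /I /ball /= sub0r normrN ltr_norml.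
pose c t : MM * R := (of_mx (sgmx e *m cayley (A t)), d_ t).
have sc : smooth_in I c.
  move=> k; apply: (Ck_pair oI); last exact: sd.
  apply: (smooth_of_mx oI).
  apply: (mx_smoothM oI (sd _ oI) (mx_smooth_sgmx oI _ e)).
  exact: (mx_smooth_cayley oI (sd _ oI) IY (sA _ oI)).
have I0 : I 0 by rewrite /I /= oppr_lt0 eps0.
have c0 : c 0 = (z, d).
  rewrite /c /A d0 of_mxK (cayleyK (Lam_two_unit d) ue) mulmxA sgmxK mul1mx.
  by rewrite to_mxK.
exists ('D_1 c 0).
  exists eps, c; split=> //.
    move=> t It; rewrite /Defs.total /= of_mxK.
    apply/isometries_sgmxM/(isometries_cayley _ _ _ (two t)).
      by apply: (cayley_dom (two t)); exact: IY.
    rewrite (cayleyK (two t) (IY t It)).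
    apply/lie_isometriesP/(lie_isometriesP d); rewrite of_mxK.
    apply/(isometries_cayley _ _ _ (Lam_two_unit d) ue)/isometries_sgmxM.
    exact: Sz.
have dc : differentiable c 0 by have [dc _] := sc 1%N; exact: dc.
have dsnd (y : MM * R) : differentiable (snd : MM * R -> R) y.
  by have [ds _] := @smooth_snd R MM R setT 1%N; exact: ds.
have ddE : 'd d_ 0 1 = w.
  have -> : d_ = cst d + w *: (id : R -> R) by [].
  have di : differentiable (id : R -> R) (0 : R) by [].
  rewrite (diffD (differentiable_cst d _) (differentiableZ w di)) /=.
  rewrite diff_cst diffZ// (@diff_lin _ _ _ idfun) => [|? //].
  by rewrite /= add0r -[LHS]/(w * 1) mulr1.
have Ec := @diff_comp R _ _ _ c snd 0 dc (dsnd _).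
by rewrite deriveE// -c0 -[LHS]/(('d snd (c 0) \o 'd c 0) 1) -Ec.
Qed.

(** Inversion is not visibly smooth off the group, where matrices may be
    singular; on the group it agrees with the globally smooth [star q]. *)
Lemma isometries_family : one_parameter_family G.
Proof.
split.
- exact: isometries_fiber_Lie.
- exact: isometries_total_submanifold.
- exact: isometries_submersion.
- move=> z _; exists setT, (@total_mul R m); split=> //; first exact: openT.
  have sd : smooth_in setT (fun z : (MM * R) * (MM * R) => z.1.2).
    move=> k; apply: Ck_linear => // x.
    apply: (@continuous_comp _ _ _ fst snd); [exact: cvg_fst|exact: cvg_snd].
  move=> k; apply: (Ck_pair openT); last exact: sd.
  apply: (smooth_of_mx openT (delta := fun z : (MM * R) * (MM * R) => z.1.2)).
  apply: (mx_smoothM openT sd).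
    apply: (@mx_smooth_to_mx _ _ _ openT (fun z => z.1.2) _
      (fun z : (MM * R) * (MM * R) => z.1.1)) => //.
    move=> x; apply: (@continuous_comp _ _ _ fst fst); exact: cvg_fst.
  apply: (@mx_smooth_to_mx _ _ _ openT (fun z => z.1.2) _
    (fun z : (MM * R) * (MM * R) => z.2.1)) => //.
  move=> x; apply: (@continuous_comp _ _ _ snd fst); [exact: cvg_snd|exact: cvg_fst].
- move=> z _.
  exists setT, (fun x => (of_mx (star (@lconj R x.2) q (to_mx x.2 x.1)), x.2)).
  split=> //; first exact: openT.
    have sd : smooth_in setT (snd : MM * R -> R) by exact: smooth_snd.
    move=> k; apply: (Ck_pair openT); last exact: sd.
    apply: (smooth_of_mx openT (delta := snd)).
    apply: (mx_smooth_star openT sd).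
    by apply: (@mx_smooth_to_mx _ _ _ openT snd _ fst) => // x;
      exact: cvg_fst.
  by move=> x _ /isometries_inv[_ E _]; rewrite /total_inv E.
- move=> k; apply: (Ck_pair openT); last by apply: (@Ck_linear _ _ _ _ _ id) => // x;
    exact: cvg_id.
  apply: (smooth_of_mx openT (delta := id)).
  exact: (mx_smooth1 openT).
Qed.

End Family.

(** * The unitary groups and the stabilisers *)

(** The value [true] stands for the sign -1. *)
Definition last_sign n (i : 'I_(n + 1)) : bool := (n <= i)%N.

Section Blocks.
Context (T : comUnitRingType) (conj : {rmorphism T -> T}) (n : nat).
Local Notation q := (@last_sign n).

Lemma sgmx_last_sign : sgmx q = block_mx 1%:M 0 0 (- 1%:M) :> 'M[T]_(n + 1).
Proof.
apply/matrixP => i j; rewrite !mxE /last_sign -val_eqE /=.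
case: (splitP i) => i' ->; rewrite mxE; case: splitP => j' ->; rewrite !mxE.
- rewrite leqNgt ltn_ord /= expr0 -val_eqE /=.
  by case: eqP.
- rewrite [i' == _ :> nat]ltn_eqF ?mulr0n// ltn_addr//.
- by rewrite eq_sym ltn_eqF ?mulr0n// ltn_addr.
- by rewrite leq_addr expr1 eqn_add2l -val_eqE mulNrn.
Qed.

(** Commuting with [sgmx q] makes both off-diagonal blocks equal to their
    opposites. *)
Lemma isometries_blockP (A : 'M[T]_(n + 1)) : (2 : T) \is a GRing.unit ->
  isometries conj q q A <-> exists B u,
    [/\ (map_mx conj B)^T *m B = 1%:M, u * conj u = 1 &
        A = block_mx B 0 0 u%:M].
Proof.
move=> two.
have starB (B : 'M[T]_n) (D : 'M[T]_1) : star conj q (block_mx B 0 0 D) =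
    block_mx (map_mx conj B)^T 0 0 (map_mx conj D)^T.
  rewrite /star sgmx_last_sign map_block_mx !map_mx0 tr_block_mx !trmx0.
  rewrite !mulmx_block !(mul0mx, mulmx0, mul1mx, mulmx1, addr0, add0r).
  by rewrite mulNmx mulmxN !mul1mx mulmx1 opprK.
have unitB (B : 'M[T]_n) (u : T) :
    star conj q (block_mx B 0 0 u%:M) *m block_mx B 0 0 u%:M = 1%:M <->
    (map_mx conj B)^T *m B = 1%:M /\ u * conj u = 1.
  rewrite starB map_scalar_mx tr_scalar_mx mulmx_block.
  rewrite !(mul0mx, mulmx0, addr0, add0r) -scalar_mxM (@scalar_mx_block T n 1 1).
  split=> [/eq_block_mx[-> _ _ E]|[-> <-] ]; last by rewrite mulrC.
  split=> //; have := congr1 (fun M : 'M[T]_1 => M ord0 ord0) E.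
  by rewrite !mxE mulrC.
have half (D : 'M[T]_(n, 1)) : D = - D -> D = 0.
  move=> /eqP; rewrite -addr_eq0 -mulr2n -scaler_nat => /eqP D0.
  by rewrite -[D]scale1r -(mulVr two) -scalerA D0 scaler0.
have half' (D : 'M[T]_(1, n)) : D = - D -> D = 0.
  move=> /eqP; rewrite -addr_eq0 -mulr2n -scaler_nat => /eqP D0.
  by rewrite -[D]scale1r -(mulVr two) -scalerA D0 scaler0.
split.
  move=> [A1]; rewrite -{1 2}(submxK A) sgmx_last_sign !mulmx_block.
  rewrite !(mul0mx, mulmx0, mul1mx, mulmx1, addr0, add0r) mulmxN mulNmx.
  rewrite mul1mx mulmx1 => /eq_block_mx[_ /esym/half ur /half' dl _].
  have EA : A = block_mx (ulsubmx A) 0 0 (drsubmx A 0 0)%:M.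
    by rewrite -[LHS]submxK ur dl -mx11_scalar.
  move: A1; rewrite EA => /unitB[B1 u1].
  by exists (ulsubmx A), (drsubmx A 0 0).
move=> [B [u [B1 u1 ->]]]; split; first exact/unitB.
rewrite sgmx_last_sign !mulmx_block.
rewrite !(mul0mx, mulmx0, mul1mx, mulmx1, addr0, add0r).
by rewrite mulmxN mulNmx mul1mx mulmx1.
Qed.

End Blocks.

Section Groups.
Context (R : realType) (delta : R) (n : nat).
Local Notation q := (@last_sign n).

Lemma U_indef_isometries :
  U_indef delta n = isometries (@lconj R delta) q (fun=> false).
Proof.
have QE : Qmx delta n = sgmx q by rewrite sgmx_last_sign.
apply/seteqP; split=> A.
  rewrite /U_indef /= QE => AQA; split; last first.
    by rewrite sgmx_false mul1mx mulmx1.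
  by rewrite /star -!mulmxA (mulmxA _ (sgmx q)) AQA sgmxK.
move=> [A1 _]; rewrite /U_indef /= QE.
have := congr1 (mulmx (sgmx q)) A1.
by rewrite mulmx1 /star !mulmxA sgmxK mul1mx.
Qed.

Lemma USt_isometries : USt delta n = isometries (@lconj R delta) q q.
Proof.
have two := Lam_two_unit delta.
apply/seteqP; split=> A.
  by move=> [B [u [B1 u1 ->]]]; apply/(isometries_blockP _ _ two); exists B, u.
by move=> /(isometries_blockP _ _ two)[B [u [B1 u1 ->]]]; exists B, u.
Qed.

(** The extra condition is that a commutator vanishes, a closed one. *)
Lemma isometries_closed_subgroup p :
  closed_subgroup (isometries (@lconj R delta) q p)
                  (isometries (@lconj R delta) q (fun=> false)).
Proof.
split=> [A /isometries_commute[] //|].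
pose f (z : 'M[R]_(n + 1) * 'M[R]_(n + 1)) :=
  of_mx (to_mx delta z *m sgmx p + - (sgmx p *m to_mx delta z)).
have sf : smooth_in setT f.
  have sd : smooth_in setT (fun _ : 'M[R]_(n + 1) * 'M[R]_(n + 1) => delta).
    exact: smooth_cst.
  have sz := @mx_smooth_to_mx R ('M[R]_(n + 1) * 'M[R]_(n + 1))%type setT openT
    (fun=> delta) _ id (fun _ _ _ => erefl) (fun x => cvg_id).
  have sp := @mx_smooth_sgmx R ('M[R]_(n + 1) * 'M[R]_(n + 1))%type setT openT
    (fun=> delta) _ p.
  apply: (smooth_of_mx openT (delta := fun=> delta)).
  apply: (mx_smoothD openT (mx_smoothM openT sd sz sp)).
  exact: (mx_smoothN openT sd (mx_smoothM openT sd sp sz)).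
exists (f @^-1` [set 0]).
  apply: preimage_closed.
    by move=> z _; exact: (sf 0%N z I).
  apply: accessible_closed_set1; apply: hausdorff_accessible; exact: norm_hausdorff.
apply/seteqP; split=> z; rewrite /coords /=.
  move=> /isometries_commute[GA AP]; split; first exact: GA.
  by rewrite /f AP subrr -(to_mx0 _ delta) to_mxK.
move=> [GA fz]; apply/isometries_commute; split; first exact: GA.
apply/eqP; rewrite -subr_eq0; apply/eqP.
by rewrite -[LHS](@of_mxK R _ delta) -(to_mx0 _ delta); congr to_mx.
Qed.

End Groups.

Theorem mainTheorem13 (R : realType) (n : nat) :
  one_parameter_geometry (fun delta : R => U_indef delta n)
                         (fun delta : R => USt delta n).
Proof.
have -> : (fun delta : R => U_indef delta n) =
          (fun delta => isometries (@lconj R delta) (@last_sign n)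
             (fun=> false)).
  by apply: functional_extensionality_dep => delta; exact: U_indef_isometries.
have -> : (fun delta : R => USt delta n) =
          (fun delta => isometries (@lconj R delta) (@last_sign n)
             (@last_sign n)).
  by apply: functional_extensionality_dep => delta; exact: USt_isometries.
split; [exact: isometries_family|exact: isometries_family|].
move=> delta; exact: isometries_closed_subgroup.
Qed.
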